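(* Consider the $\beta$-plane problem with centripetal forces (system (E), incompressibility (M), boundary conditions (B1)–(B3) as set out in the context), for flows whose vorticity vector $\mathbf{\Upsilon}=(\Upsilon_1,\Upsilon_2,\Upsilon_3)$ satisfies $\Upsilon_2+\hat f\neq0$ and $\Upsilon_3+f\neq0$. There is no water flow exhibiting a non-zero constant vorticity vector and with a flat surface. Indeed, any flow with a flat surface and constant vorticity vector must have vanishing vorticity vector, that is, $\mathbf{\Upsilon}=(0,0,0)$.
   Context: Constants: $\Omega>0$ (rotational speed of the Earth), $R>0$ (radius of the Earth), $g>0$ (gravitational acceleration), $\rho>0$ (constant water density), $P_{atm}$ (constant atmospheric pressure), $d>0$ (the flat bed is $z=-d$), $c>0$ (wave speed), $L>0$ (wave period). The latitude $\phi\in(-\pi/2,\pi/2)$ is fixed, and $f=2\Omega\sin\phi$, $\hat f=2\Omega\cos\phi\neq0$, $\beta=\hat f/R$ are constants. Free surface and fluid domain: the free surface is $z=\eta(x-ct)$, where $\eta$ is an $L$-periodic function of one real variable with $\eta>-d$ and zero mean $\int_0^L\eta(s)\,ds=0$. The surface is flat if $\eta$ is constant. The surface does not depend on $y$. The fluid domain at time $t$ is $\{(x,y,z): x,y\in\mathbb{R},\ -d\le z\le \eta(x-ct)\}$. The velocity field $\mathbf{u}=(u,v,w)$ and the pressure $P$ are functions of $(x,y,z,t)$, sufficiently smooth (classical) in the fluid domain up to its boundary. A ''(water) flow'' is a solution $(u,v,w,P,\eta)$ of (E), (M), (B1), (B2), (B3) below. (E) ($\beta$-plane equations with centripetal terms):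 $$u_t+uu_x+vu_y+wu_z+\hat f w-(f+\beta y)v=-\tfrac1\rho P_x,$$ $$v_t+uv_x+vv_y+wv_z+(f+\beta y)u+\tfrac{\hat f^2}{4}y+\tfrac{\hat f f}{4}R=-\tfrac1\rho P_y,$$ $$w_t+uw_x+vw_y+ww_z-\hat f u-\tfrac{\hat f^2}{4}R=-\tfrac1\rho P_z-g.$$ (M) (incompressibility): $u_x+v_y+w_z=0$. (B1) $P=P_{atm}$ on $z=\eta(x-ct)$. (B2) $w=(u-c)\eta_x$ on $z=\eta(x-ct)$. (B3) $w=0$ on $z=-d$. The vorticity vector is $\mathbf{\Upsilon}=(\Upsilon_1,\Upsilon_2,\Upsilon_3)=(w_y-v_z,\ u_z-w_x,\ v_x-u_y)$; ''constant'' means that it does not depend on $(x,y,z,t)$. *)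

(* Defs.v *)
From Stdlib Require Import Reals.
From Coquelicot Require Import Coquelicot.
Open Scope R_scope.

(* Scalar fields depend on (x, y, z, t), in this order. *)
Definition field := R -> R -> R -> R -> R.

Definition uncurry4 (f : field) : R * R * R * R -> R :=
  fun p => let '(x, y, z, t) := p in f x y z t.

Definition Dx (f : field) : field := fun x y z t => Derive (fun s => f s y z t) x.
Definition Dy (f : field) : field := fun x y z t => Derive (fun s => f x s z t) y.
Definition Dz (f : field) : field := fun x y z t => Derive (fun s => f x y s t) z.
Definition Dt (f : field) : field := fun x y z t => Derive (fun s => f x y z s) t.

Definition coriolis_f (Omega phi : R) : R := 2 * Omega * sin phi.
Definition coriolis_fhat (Omega phi : R) : R := 2 * Omega * cos phi.
Definition coriolis_beta (Omega Rad phi : R) : R := coriolis_fhat Omega phi / Rad.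

Definition fluid_domain (d c : R) (eta : R -> R) (p : R * R * R * R) : Prop :=
  let '(x, y, z, t) := p in - d <= z <= eta (x - c * t).

Definition fluid_interior (d c : R) (eta : R -> R) (x y z t : R) : Prop :=
  - d < z < eta (x - c * t).

(* C^k up to the boundary: the partial derivatives of order <= k in
   (x, y, z, t) exist in the interior and extend continuously to the closed
   domain.  Consequently an identity between such derivatives that holds in the
   interior holds, by continuity, for their extensions on the whole domain. *)
Fixpoint Ck_up_to_boundary (k : nat) (d c : R) (eta : R -> R) (f : field) : Prop :=
  continuous_on (fluid_domain d c eta) (uncurry4 f) /\
  match k with
  | O => True
  | S k' =>
      exists fx fy fz ft : field,
        (forall x y z t, fluid_interior d c eta x y z t ->
           is_derive (fun s => f s y z t) x (fx x y z t) /\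
           is_derive (fun s => f x s z t) y (fy x y z t) /\
           is_derive (fun s => f x y s t) z (fz x y z t) /\
           is_derive (fun s => f x y z s) t (ft x y z t)) /\
        Ck_up_to_boundary k' d c eta fx /\
        Ck_up_to_boundary k' d c eta fy /\
        Ck_up_to_boundary k' d c eta fz /\
        Ck_up_to_boundary k' d c eta ft
  end.

(* q_t + u q_x + v q_y + w q_z *)
Definition material (u v w q : field) : field := fun x y z t =>
  Dt q x y z t + u x y z t * Dx q x y z t + v x y z t * Dy q x y z t
  + w x y z t * Dz q x y z t.

Definition euler_x (Omega Rad phi rho : R) (u v w P : field) (x y z t : R) : Prop :=
  material u v w u x y z t
  + coriolis_fhat Omega phi * w x y z t
  - (coriolis_f Omega phi + coriolis_beta Omega Rad phi * y) * v x y z t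
  = - (1 / rho) * Dx P x y z t.

Definition euler_y (Omega Rad phi rho : R) (u v w P : field) (x y z t : R) : Prop :=
  material u v w v x y z t
  + (coriolis_f Omega phi + coriolis_beta Omega Rad phi * y) * u x y z t
  + (coriolis_fhat Omega phi) ^ 2 / 4 * y
  + coriolis_fhat Omega phi * coriolis_f Omega phi / 4 * Rad
  = - (1 / rho) * Dy P x y z t.

Definition euler_z (Omega Rad phi rho g : R) (u v w P : field) (x y z t : R) : Prop :=
  material u v w w x y z t
  - coriolis_fhat Omega phi * u x y z t
  - (coriolis_fhat Omega phi) ^ 2 / 4 * Rad
  = - (1 / rho) * Dz P x y z t - g.

Definition incompressible (u v w : field) (x y z t : R) : Prop :=
  Dx u x y z t + Dy v x y z t + Dz w x y z t = 0.

Record free_surface (d L : R) (eta : R -> R) : Prop := {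
  surface_derivable : forall s, ex_derive eta s;
  surface_derive_continuous : forall s, continuous (Derive eta) s;
  surface_periodic : forall s, eta (s + L) = eta s;
  surface_above_bed : forall s, - d < eta s;
  surface_zero_mean : RInt eta 0 L = 0
}.

(* Velocity C^2 is the regularity at which the curl of the momentum equations
   makes sense classically; C^1 is enough for the pressure. *)
Record water_flow (Omega Rad g rho Patm d c L phi : R)
    (u v w P : field) (eta : R -> R) : Prop := {
  flow_surface : free_surface d L eta;
  flow_smooth_u : Ck_up_to_boundary 2 d c eta u;
  flow_smooth_v : Ck_up_to_boundary 2 d c eta v;
  flow_smooth_w : Ck_up_to_boundary 2 d c eta w;
  flow_smooth_P : Ck_up_to_boundary 1 d c eta P;
  flow_euler_x : forall x y z t, fluid_interior d c eta x y z t ->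
    euler_x Omega Rad phi rho u v w P x y z t;
  flow_euler_y : forall x y z t, fluid_interior d c eta x y z t ->
    euler_y Omega Rad phi rho u v w P x y z t;
  flow_euler_z : forall x y z t, fluid_interior d c eta x y z t ->
    euler_z Omega Rad phi rho g u v w P x y z t;
  flow_incompressible : forall x y z t, fluid_interior d c eta x y z t ->
    incompressible u v w x y z t;
  flow_surface_pressure : forall x y t,
    P x y (eta (x - c * t)) t = Patm;
  flow_surface_kinematic : forall x y t,
    w x y (eta (x - c * t)) t
    = (u x y (eta (x - c * t)) t - c) * Derive (fun s => eta (s - c * t)) x;
  flow_bed_kinematic : forall x y t, w x y (- d) t = 0
}.

Definition vorticity (u v w : field) (x y z t : R) : R * R * R :=
  (Dy w x y z t - Dz v x y z t,
   Dz u x y z t - Dx w x y z t,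
   Dx v x y z t - Dy u x y z t).

Definition constant_vorticity (d c : R) (eta : R -> R) (u v w : field)
    (Y1 Y2 Y3 : R) : Prop :=
  forall x y z t, fluid_interior d c eta x y z t ->
    vorticity u v w x y z t = (Y1, Y2, Y3).

Definition flat_surface (eta : R -> R) : Prop :=
  exists h : R, forall s, eta s = h.

(* Main.v *)
(** Write [a = Y1], [b = Y2 + fhat], [Y = Y3 + f + beta y].  In Bernoulli form the
    momentum equations say that [u_t + (a, b, Y) x u] is a gradient; its curl gives
    [(a d_x + b d_y + Y d_z)(u, v, w) = (0, 0, beta v)].  On the bed [w], [w_x] and
    [w_y] vanish, so there [v_z = - Y1], [u_z = Y2], [Y w_z = beta v], and
    eliminating [u] leaves
    [(a^2 + b^2) v_y = - a^2 beta v / Y + (affine in Y)] with [v = 0] at [Y = 0].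
    Hence [v = p Y^2 + q Y] for [Y > 0]: the square of the difference is
    nonincreasing and vanishes at [Y = 0].  Then [v_x = 0] and [u_y = - Y3], so [u_x]
    is independent of [y], which forces [p = 0], and then [a = q = Y2 = Y3 = 0].
    Only the bed matters: the flatness of the surface just makes the domain a slab. *)

Require Import Defs.
From Stdlib Require Import Reals Lra.
From Coquelicot Require Import Coquelicot.
Open Scope R_scope.

(** * Differentiation lemmas: limits of derivatives and equality of mixed partials *)

(** By the mean value theorem each difference quotient of [F n] at [x] is a value of [G n] near [x],
    hence close to [l]; this bound survives the limit in [n]. It serves to differentiate along the
    bed, where derivatives are known only as limits from the interior. *)
Lemma is_derive_seq_limit (F G : nat -> R -> R) (f : R -> R) (x l : R) :
  (forall s, is_lim_seq (fun n => F n s) (f s)) ->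
  (forall n s, is_derive (F n) s (G n s)) ->
  (forall eps : posreal, exists delta : posreal, eventually (fun n =>
     forall s, Rabs (s - x) < delta -> Rabs (G n s - l) < eps)) ->
  is_derive f x l.
Proof.
intros HF HG Hl.
apply is_derive_Reals; intros eps Heps.
(* Half of [eps], because the limit in [n] keeps only the weak inequality. *)
assert (Heps2 : 0 < eps / 2) by lra.
destruct (Hl (mkposreal _ Heps2)) as [delta [N HN]]; simpl in HN.
exists delta; intros k Hk Hkd.
assert (Hbound : Rabs (f (x + k) - f x - l * k) <= eps / 2 * Rabs k).
{ assert (Hlim : is_lim_seq (fun n => Rabs (F n (x + k) - F n x - l * k))
                   (Rabs (f (x + k) - f x - l * k))).
  { apply (is_lim_seq_abs _ (Finite _)), is_lim_seq_minus'.
    - apply is_lim_seq_minus'; apply HF.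
    - apply is_lim_seq_const. }
  refine (is_lim_seq_le_loc _ (fun _ => eps / 2 * Rabs k) (Finite _) (Finite _)
            _ Hlim (is_lim_seq_const _)).
  exists N; intros n Hn.
  destruct (MVT_gen (F n) x (x + k) (G n)) as [xi [Hxi Heq]].
  - intros s _; apply HG.
  - intros s _; apply derivable_continuous_pt.
    exists (G n s); apply is_derive_Reals, HG.
  - replace (F n (x + k) - F n x - l * k) with ((G n xi - l) * k)
      by (rewrite Heq; ring).
    rewrite Rabs_mult; apply Rmult_le_compat_r; [apply Rabs_pos |].
    left; apply HN; [exact Hn |].
    apply Rle_lt_trans with (2 := Hkd).
    revert Hxi; unfold Rmin, Rmax, Rabs.
    destruct (Rle_dec x (x + k)); destruct (Rcase_abs (xi - x));
      destruct (Rcase_abs k); lra. }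
replace ((f (x + k) - f x) / k - l) with ((f (x + k) - f x - l * k) / k)
  by (field; exact Hk).
unfold Rdiv; rewrite Rabs_mult, Rabs_inv.
assert (Hk0 := Rabs_pos_lt _ Hk).
apply Rmult_lt_reg_r with (Rabs k); [exact Hk0 |].
rewrite Rmult_assoc, Rinv_l by lra.
nra.
Qed.

(** Schwarz's theorem for partial derivatives given as functions on a neighbourhood [D]: inside [D]
    they can be traded for [Derive]. *)
Lemma mixed_partials_eq (D : R -> R -> Prop) (f f1 f2 f12 f21 : R -> R -> R)
    (a b : R) :
  locally_2d D a b ->
  (forall s r, D s r -> is_derive (fun s => f s r) s (f1 s r)) ->
  (forall s r, D s r -> is_derive (fun r => f s r) r (f2 s r)) ->
  (forall s r, D s r -> is_derive (fun r => f1 s r) r (f12 s r)) ->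
  (forall s r, D s r -> is_derive (fun s => f2 s r) s (f21 s r)) ->
  continuity_2d_pt f12 a b -> continuity_2d_pt f21 a b ->
  f12 a b = f21 a b.
Proof.
intros HD H1 H2 H12 H21 C12 C21.
assert (Hloc : forall s r, locally_2d D s r ->
   locally r (fun r' => D s r') /\ locally s (fun s' => D s' r)).
{ intros s r [delta Hd]; split; exists delta; intros q Hq; apply Hd;
    try exact Hq; rewrite Rminus_diag, Rabs_R0; apply cond_pos. }
assert (E12 : forall s r, locally_2d D s r ->
   is_derive (fun r => Derive (fun s => f s r) s) r (f12 s r)).
{ intros s r Hsr; apply is_derive_ext_loc with (fun r => f1 s r).
  - apply (filter_imp (fun r' => D s r')); [| apply Hloc, Hsr].
    intros q Hq; symmetry; apply is_derive_unique, H1, Hq.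
  - apply H12, (locally_2d_singleton _ _ _ Hsr). }
assert (E21 : forall s r, locally_2d D s r ->
   is_derive (fun s => Derive (fun r => f s r) r) s (f21 s r)).
{ intros s r Hsr; apply is_derive_ext_loc with (fun s => f2 s r).
  - apply (filter_imp (fun s' => D s' r)); [| apply Hloc, Hsr].
    intros q Hq; symmetry; apply is_derive_unique, H2, Hq.
  - apply H21, (locally_2d_singleton _ _ _ Hsr). }
(* Trading [f1] or [f2] for [Derive] under a further derivative takes a whole neighbourhood, so
   every point near [(a, b)] must have one inside [D]. *)
assert (HDD : locally_2d (fun s r => locally_2d D s r) a b)
  by (apply locally_2d_impl_strong with (2 := HD), locally_2d_forall; auto).
rewrite <- (is_derive_unique _ _ _ (E12 a b HD)).
rewrite <- (is_derive_unique _ _ _ (E21 a b HD)).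
symmetry; apply Schwarz.
- apply locally_2d_impl with (2 := HDD), locally_2d_forall; intros s r Hsr.
  assert (Dsr := locally_2d_singleton _ _ _ Hsr).
  split; [exists (f1 s r); apply H1, Dsr |].
  split; [exists (f2 s r); apply H2, Dsr |].
  split; [exists (f21 s r); apply E21, Hsr | exists (f12 s r); apply E12, Hsr].
- apply continuity_2d_pt_ext_loc with (2 := C21).
  apply locally_2d_impl with (2 := HDD), locally_2d_forall; intros s r Hsr.
  symmetry; apply is_derive_unique, E21, Hsr.
- apply continuity_2d_pt_ext_loc with (2 := C12).
  apply locally_2d_impl with (2 := HDD), locally_2d_forall; intros s r Hsr.
  symmetry; apply is_derive_unique, E12, Hsr.
Qed.

(** * The system on the bed *)

(* U, V, W are the bed traces of u, v, w_z. *)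
Lemma bed_vorticity_zero (a b e B m k : R) (U V Ux Uy Vx Vy W : R -> R -> R) :
  0 < B -> b <> 0 ->
  (forall x y, is_derive (fun s => U s y) x (Ux x y)) ->
  (forall x y, is_derive (fun s => U x s) y (Uy x y)) ->
  (forall x y, is_derive (fun s => V s y) x (Vx x y)) ->
  (forall x y, is_derive (fun s => V x s) y (Vy x y)) ->
  (forall x y, Vx x y - Uy x y = k) ->
  (forall x y, Ux x y + Vy x y + W x y = 0) ->
  (forall x y, a * Ux x y + b * Uy x y + (e + B * y) * m = 0) ->
  (forall x y, a * Vx x y + b * Vy x y - (e + B * y) * a = 0) ->
  (forall x y, (e + B * y) * W x y = B * V x y) ->
  a = 0 /\ m = 0 /\ k = 0.
Proof.
intros HB Hb DUx DUy DVx DVy Hk Hdiv HU HV HW.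
set (D := a ^ 2 + b ^ 2).
assert (HD : 0 < D) by (unfold D; nra).
(* [p] and [q] come from inserting [p Y^2 + q Y] into [D Y V_y = - a^2 B V + a (b + m) Y^2 - a b k
   Y], the equation left for [V] after elimination. *)
set (p := a * (b + m) / (B * (2 * D + a ^ 2))).
set (q := - (a * b * k) / (B * (D + a ^ 2))).
assert (Hp : p * (B * (2 * D + a ^ 2)) = a * (b + m))
  by (unfold p; field; split; nra).
assert (Hq : q * (B * (D + a ^ 2)) = - (a * b * k))
  by (unfold q; field; split; nra).
set (Y := fun y => e + B * y).
set (S := fun x y => V x y - (p * Y y ^ 2 + q * Y y)).
(* The line where [Y] vanishes; as [B > 0], [Y] is positive for [y > y0]. *)
set (y0 := - e / B).
assert (HY0 : Y y0 = 0) by (unfold Y, y0; field; lra).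
assert (HYpos : forall y, y0 < y -> 0 < Y y).
{ intros y Hy. replace (Y y) with (B * (y - y0)) by (unfold Y, y0; field; lra).
  apply Rmult_lt_0_compat; lra. }
(* The difference [S] solves the homogeneous equation [D Y S_y = - a^2 B S]. *)
assert (HSode : forall x y,
  D * (Y y * (Vy x y - B * (2 * p * Y y + q))) = - (a ^ 2 * B) * S x y).
{ intros x y; unfold S; specialize (Hk x y); specialize (Hdiv x y);
    specialize (HU x y); specialize (HV x y); specialize (HW x y).
  fold (Y y) in *.
  assert (Ha : a * Vy x y = b * Vx x y - b * k + Y y * m - a * W x y).
  { replace (Uy x y) with (Vx x y - k) in HU by lra.
    replace (Ux x y) with (- Vy x y - W x y) in HU by lra. lra. }
  (* [a] times [Ha] plus [b] times [HV]: the [Vx] terms cancel. *)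
  assert (Hlin : D * Vy x y = a * b * (Y y - k) + a * m * Y y - a ^ 2 * W x y).
  { replace (D * Vy x y) with (a * (a * Vy x y) + b * (b * Vy x y))
      by (unfold D; ring).
    rewrite Ha. replace (b * Vy x y) with (Y y * a - a * Vx x y) by lra. ring. }
  replace (D * (Y y * (Vy x y - B * (2 * p * Y y + q))))
    with (Y y * (D * Vy x y) - D * B * Y y * (2 * p * Y y + q)) by ring.
  rewrite Hlin.
  transitivity (a * b * (Y y - k) * Y y + a * m * Y y ^ 2 - a ^ 2 * (Y y * W x y)
    - (p * (B * (2 * D + a ^ 2))) * Y y ^ 2 - (q * (B * (D + a ^ 2))) * Y y
    + a ^ 2 * B * (p * Y y ^ 2 + q * Y y)); [ring |].
  rewrite Hp, Hq, HW; ring. }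
assert (DS : forall x y,
  is_derive (fun s => S x s ^ 2) y (2 * S x y * (Vy x y - B * (2 * p * Y y + q)))).
{ intros x y; unfold S, Y; specialize (DVy x y).
  auto_derive; [exists (Vy x y); exact DVy |].
  replace (Derive _ y) with (Vy x y)
    by (symmetry; apply is_derive_unique; exact DVy); ring. }
(* For [Y > 0] the equation gives [(S^2)_y <= 0], and [S = 0] at [y0] because [HW] reads [B V = 0]
   there; a square starting from zero can then only stay zero. *)
assert (HS : forall x y, y0 < y -> S x y = 0).
{ intros x y Hy.
  assert (HS0 : S x y0 = 0).
  { unfold S; rewrite HY0. specialize (HW x y0); fold (Y y0) in HW.
    rewrite HY0 in HW. assert (B * V x y0 = 0) by lra.
    destruct (Rmult_integral _ _ H); lra. }
  destruct (MVT_gen (fun s => S x s ^ 2) y0 y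
    (fun y => 2 * S x y * (Vy x y - B * (2 * p * Y y + q)))) as [xi [Hxi Heq]].
  - intros s _; apply DS.
  - intros s _; apply derivable_continuous_pt.
    eexists; apply is_derive_Reals, DS.
  - rewrite Rmin_left, Rmax_right in Hxi by lra.
    simpl in Heq; rewrite HS0 in Heq.
    assert (Hle : 2 * S x xi * (Vy x xi - B * (2 * p * Y xi + q)) * (y - y0) <= 0).
    (* The mean value point may be [y0] itself, where [Y] is not positive but [S] vanishes. *)
    { destruct (proj1 Hxi) as [Hlt | <-]; [| rewrite HS0; lra].
      specialize (HYpos xi Hlt); specialize (HSode x xi).
      set (T := Vy x xi - B * (2 * p * Y xi + q)) in *.
      assert (HT : D * Y xi * (S x xi * T) = - (a ^ 2 * B) * S x xi ^ 2)
        by (replace (D * Y xi * (S x xi * T)) with (S x xi * (D * (Y xi * T)))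
              by ring; rewrite HSode; ring).
      assert (0 <= a ^ 2 * B * S x xi ^ 2)
        by (apply Rmult_le_pos; [apply Rmult_le_pos |]; auto using pow2_ge_0, Rlt_le).
      assert (0 < D * Y xi) by (apply Rmult_lt_0_compat; lra).
      assert (S x xi * T <= 0) by (apply Rmult_le_reg_l with (D * Y xi); lra).
      nra. }
    nra. }
assert (Hloc : forall y, y0 < y -> locally y (fun s => y0 < s))
  by (intros y Hy; apply (open_gt y0 y Hy)).
assert (HVx : forall x y, y0 < y -> Vx x y = 0).
{ intros x y Hy; rewrite <- (is_derive_unique _ _ _ (DVx x y)).
  rewrite (Derive_ext _ (fun _ => p * Y y ^ 2 + q * Y y)); [apply Derive_const |].
  intros s; specialize (HS s y Hy); unfold S in HS; lra. }
assert (HVy : forall x y, y0 < y -> Vy x y = B * (2 * p * Y y + q)).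
{ intros x y Hy; rewrite <- (is_derive_unique _ _ _ (DVy x y)).
  apply is_derive_unique, is_derive_ext_loc with (fun s => p * Y s ^ 2 + q * Y s).
  - apply filter_imp with (2 := Hloc y Hy); intros s Hs.
    specialize (HS x s Hs); unfold S in HS; lra.
  - unfold Y; auto_derive; [exact I | ring]. }
(* Incompressibility with [W = B V / Y = B (p Y + q)]. *)
assert (HUx : forall x y, y0 < y -> Ux x y = - B * (3 * p * Y y + 2 * q)).
{ intros x y Hy; specialize (HYpos y Hy); specialize (HS x y Hy).
  specialize (Hdiv x y); specialize (HW x y); fold (Y y) in HW.
  rewrite HVy in Hdiv by exact Hy. unfold S in HS.
  apply Rmult_eq_reg_l with (Y y); [| lra].
  replace (Ux x y) with (- W x y - B * (2 * p * Y y + q)) by lra.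
  replace (Y y * (- W x y - B * (2 * p * Y y + q)))
    with (- (Y y * W x y) - Y y * B * (2 * p * Y y + q)) by ring.
  rewrite HW. replace (V x y) with (p * Y y ^ 2 + q * Y y) by lra. ring. }
(* On these two lines [Y] equals [B] and [2 B], which is enough to separate the coefficients of an
   expression affine in [Y]. *)
set (y1 := y0 + 1). set (y2 := y0 + 2).
assert (H1 : y0 < y1) by (unfold y1; lra).
assert (H2 : y0 < y2) by (unfold y2; lra).
assert (HY1 : Y y1 = B) by (unfold Y, y1, y0; field; lra).
assert (HY2 : Y y2 = 2 * B) by (unfold Y, y2, y0; field; lra).
(* Since [Uy = - k] for [y > y0], the restrictions of [U] to the two lines differ by the constant
   [k] and have the same [x]-derivative. *)
assert (HUxy : Ux 0 y2 = Ux 0 y1).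
{ assert (HUd : forall x, U x y2 = U x y1 - k).
  { intros x; destruct (MVT_gen (fun s => U x s) y1 y2 (Uy x)) as [xi [Hxi Heq]].
    - intros s _; apply DUy.
    - intros s _; apply derivable_continuous_pt.
      eexists; apply is_derive_Reals, DUy.
    - rewrite Rmin_left, Rmax_right in Hxi by (unfold y1, y2; lra).
      assert (Hxi0 : y0 < xi) by lra.
      specialize (Hk x xi); rewrite HVx in Hk by exact Hxi0.
      replace (Uy x xi) with (- k) in Heq by lra.
      replace (y2 - y1) with 1 in Heq by (unfold y1, y2; ring). lra. }
  rewrite <- (is_derive_unique _ _ _ (DUx 0 y2)).
  apply is_derive_unique, is_derive_ext with (fun s => U s y1 - k).
  - intros s; symmetry; apply HUd.
  - specialize (DUx 0 y1); auto_derive; [eexists; exact DUx |].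
    replace (Derive _ 0) with (Ux 0 y1)
      by (symmetry; apply is_derive_unique; exact DUx); ring. }
rewrite !HUx, HY1, HY2 in HUxy by assumption.
assert (Hp0 : p = 0).
{ apply Rmult_eq_reg_l with (3 * B * B); [lra | nra]. }
(* With [p = 0], [HV] reads [b B q = a Y], so comparing the two lines gives [a = 0]; then [HU] reads
   [b k = m Y], which gives [m = 0] and, as [b <> 0], [k = 0]. *)
assert (HV1 := HV 0 y1). assert (HV2 := HV 0 y2).
assert (HU1 := HU 0 y1). assert (HU2 := HU 0 y2).
assert (Hk1 := Hk 0 y1). assert (Hk2 := Hk 0 y2).
fold (Y y1) in HV1, HU1. fold (Y y2) in HV2, HU2.
rewrite HVx, HVy, HY1, Hp0 in HV1 by assumption.
rewrite HVx, HVy, HY2, Hp0 in HV2 by assumption.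
assert (Ha : a = 0) by (apply Rmult_eq_reg_l with B; lra).
rewrite HVx in Hk1, Hk2 by assumption.
rewrite Ha, HY1 in HU1; rewrite Ha, HY2 in HU2.
replace (Uy 0 y1) with (- k) in HU1 by lra.
replace (Uy 0 y2) with (- k) in HU2 by lra.
assert (Hm : m = 0) by (apply Rmult_eq_reg_l with B; lra).
repeat split; try assumption.
apply Rmult_eq_reg_l with b; [| exact Hb]. rewrite Hm in HU1; lra.
Qed.

(** * Continuity on the slab and traces on the bed *)

(** Continuity relative to the closed slab, hence one-sided in [z] at the bed. The explicit form
    with one [delta] for all coordinates serves both two-variable slices and sequences descending to
    the bed. *)
Definition slab_continuous (d h : R) (G : field) : Prop :=
  forall x y z t, - d <= z <= h -> forall eps : posreal, exists delta : posreal,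
    forall x' y' z' t', - d <= z' <= h ->
      Rabs (x' - x) < delta -> Rabs (y' - y) < delta ->
      Rabs (z' - z) < delta -> Rabs (t' - t) < delta ->
      Rabs (G x' y' z' t' - G x y z t) < eps.

Lemma continuous_on_slab (d c h : R) (eta : R -> R) (G : field) :
  (forall s, eta s = h) ->
  continuous_on (fluid_domain d c eta) (uncurry4 G) -> slab_continuous d h G.
Proof.
intros Heta HG x y z t Hz eps.
assert (Hdom : fluid_domain d c eta (x, y, z, t)) by (simpl; rewrite Heta; lra).
destruct (HG _ Hdom _ (locally_ball (G x y z t) eps)) as [delta Hdelta].
exists delta; intros x' y' z' t' Hz' Hx Hy Hzz Ht.
apply (Hdelta (x', y', z', t')).
- repeat split; assumption.
- simpl; rewrite Heta; lra.
Qed.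

(** The strict bounds on [Z a b] keep nearby points in the slab. This supplies the continuity that
    [mixed_partials_eq] asks of the mixed partials. *)
Lemma slab_continuous_comp (d h : R) (G : field) (X Y Z T : R -> R -> R)
    (a b : R) :
  slab_continuous d h G -> - d < Z a b < h ->
  continuity_2d_pt X a b -> continuity_2d_pt Y a b ->
  continuity_2d_pt Z a b -> continuity_2d_pt T a b ->
  continuity_2d_pt (fun s r => G (X s r) (Y s r) (Z s r) (T s r)) a b.
Proof.
intros HG Hz HX HY HZ HT eps.
destruct (HG (X a b) (Y a b) (Z a b) (T a b)) with eps as [delta Hdelta]; [lra |].
assert (Hm : 0 < Rmin (Z a b + d) (h - Z a b)) by (apply Rmin_pos; lra).
apply locally_2d_impl with (2 := HZ (mkposreal _ Hm)).
apply locally_2d_impl with (2 := HZ delta).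
apply locally_2d_impl with (2 := HT delta).
apply locally_2d_impl with (2 := HY delta).
apply locally_2d_impl with (2 := HX delta).
apply locally_2d_forall; simpl; intros s r hX hY hT hZ hm.
apply Hdelta; try assumption.
pose proof (Rmin_l (Z a b + d) (h - Z a b)).
pose proof (Rmin_r (Z a b + d) (h - Z a b)).
apply Rabs_def2 in hm; lra.
Qed.

(** The [2] makes the fraction of the depth less than one already for [n = 0], so every term lies
    strictly inside the slab. *)
Definition above_bed (d h : R) (n : nat) : R := - d + (h + d) / (INR n + 2).

Lemma above_bed_interior (d h : R) (n : nat) :
  - d < h -> - d < above_bed d h n < h.
Proof.
intros Hh; unfold above_bed; pose proof (pos_INR n).
assert (Hfrac : 0 < / (INR n + 2) < 1).
{ split; [apply Rinv_0_lt_compat; lra |].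
  rewrite <- Rinv_1; apply Rinv_lt_contravar; lra. }
unfold Rdiv; split; nra.
Qed.

Lemma above_bed_lim (d h : R) : is_lim_seq (above_bed d h) (- d).
Proof.
replace (- d) with (- d + (h + d) * 0) by ring.
apply is_lim_seq_plus'; [apply is_lim_seq_const |].
apply is_lim_seq_mult'; [apply is_lim_seq_const |].
apply (is_lim_seq_inv _ p_infty); [| discriminate].
apply (is_lim_seq_plus _ _ p_infty 2); [apply is_lim_seq_INR | apply is_lim_seq_const | reflexivity].
Qed.

Lemma above_bed_close (d h : R) (eps : posreal) :
  eventually (fun n => Rabs (above_bed d h n - - d) < eps).
Proof. exact (proj2 (is_lim_seq_spec _ _) (above_bed_lim d h) eps). Qed.

Lemma slab_bed_lim (d h : R) (G : field) (x y t : R) :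
  - d < h -> slab_continuous d h G ->
  is_lim_seq (fun n => G x y (above_bed d h n) t) (G x y (- d) t).
Proof.
intros Hh HG; apply is_lim_seq_spec; intros eps.
destruct (HG x y (- d) t) with eps as [delta Hdelta]; [lra |].
apply filter_imp with (2 := above_bed_close d h delta); intros n Hn.
pose proof (above_bed_interior d h n Hh).
apply Hdelta; try exact Hn; try lra;
  rewrite Rminus_diag, Rabs_R0; apply cond_pos.
Qed.

(** Horizontal lines at heights [above_bed d h n] converge to a line on the bed, and continuity of
    [Gx] up to the bed gives the uniform closeness required by [is_derive_seq_limit]. *)
Lemma bed_trace_is_derive_x (d h : R) (G Gx : field) (x y t : R) :
  - d < h -> slab_continuous d h G -> slab_continuous d h Gx ->
  (forall x y z t, - d < z < h -> is_derive (fun s => G s y z t) x (Gx x y z t)) ->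
  is_derive (fun s => G s y (- d) t) x (Gx x y (- d) t).
Proof.
intros Hh HG HGx HD.
apply is_derive_seq_limit with
  (F := fun n s => G s y (above_bed d h n) t)
  (G := fun n s => Gx s y (above_bed d h n) t).
- intros s; apply slab_bed_lim; assumption.
- intros n s; apply HD, above_bed_interior, Hh.
- intros eps; destruct (HGx x y (- d) t) with eps as [delta Hdelta]; [lra |].
  exists delta; apply filter_imp with (2 := above_bed_close d h delta).
  intros n Hn s Hs; pose proof (above_bed_interior d h n Hh).
  apply Hdelta; try assumption; try lra;
    rewrite Rminus_diag, Rabs_R0; apply cond_pos.
Qed.

Lemma bed_trace_is_derive_y (d h : R) (G Gy : field) (x y t : R) :
  - d < h -> slab_continuous d h G -> slab_continuous d h Gy ->
  (forall x y z t, - d < z < h -> is_derive (fun s => G x s z t) y (Gy x y z t)) ->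
  is_derive (fun s => G x s (- d) t) y (Gy x y (- d) t).
Proof.
intros Hh HG HGy HD.
apply is_derive_seq_limit with
  (F := fun n s => G x s (above_bed d h n) t)
  (G := fun n s => Gy x s (above_bed d h n) t).
- intros s; apply slab_bed_lim; assumption.
- intros n s; apply HD, above_bed_interior, Hh.
- intros eps; destruct (HGy x y (- d) t) with eps as [delta Hdelta]; [lra |].
  exists delta; apply filter_imp with (2 := above_bed_close d h delta).
  intros n Hn s Hs; pose proof (above_bed_interior d h n Hh).
  apply Hdelta; try assumption; try lra;
    rewrite Rminus_diag, Rabs_R0; apply cond_pos.
Qed.

(** * Velocity fields of class C^2 and exchange of their time derivatives *)

Lemma locally_2d_between_fst (l u a b : R) :
  l < a < u -> locally_2d (fun s _ => l < s < u) a b.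
Proof.
intros Ha; assert (Hm : 0 < Rmin (a - l) (u - a)) by (apply Rmin_pos; lra).
exists (mkposreal _ Hm); simpl; intros s _ Hs _.
pose proof (Rmin_l (a - l) (u - a)); pose proof (Rmin_r (a - l) (u - a)).
apply Rabs_def2 in Hs; lra.
Qed.

Lemma locally_2d_between_snd (l u a b : R) :
  l < b < u -> locally_2d (fun _ r => l < r < u) a b.
Proof.
intros Hb; destruct (locally_2d_between_fst l u b a Hb) as [delta Hd].
exists delta; intros s r Hs Hr; apply (Hd r s Hr Hs).
Qed.

(* A C^2 field whose mixed time derivatives have already been exchanged. *)
Record regular (d h : R) (f fx fy fz ft ftx fty ftz : field) : Prop := {
  reg_cont : slab_continuous d h f;
  reg_cont_x : slab_continuous d h fx;
  reg_cont_y : slab_continuous d h fy;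
  reg_cont_z : slab_continuous d h fz;
  reg_cont_tx : slab_continuous d h ftx;
  reg_cont_ty : slab_continuous d h fty;
  reg_cont_tz : slab_continuous d h ftz;
  reg_x : forall x y z t, - d < z < h ->
    is_derive (fun s => f s y z t) x (fx x y z t);
  reg_y : forall x y z t, - d < z < h ->
    is_derive (fun s => f x s z t) y (fy x y z t);
  reg_z : forall x y z t, - d < z < h ->
    is_derive (fun s => f x y s t) z (fz x y z t);
  reg_t : forall x y z t, - d < z < h ->
    is_derive (fun s => f x y z s) t (ft x y z t);
  reg_tx : forall x y z t, - d < z < h ->
    is_derive (fun s => ft s y z t) x (ftx x y z t);
  reg_ty : forall x y z t, - d < z < h ->
    is_derive (fun s => ft x s z t) y (fty x y z t);
  reg_tz : forall x y z t, - d < z < h ->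
    is_derive (fun s => ft x y s t) z (ftz x y z t);
  reg_xt : forall x y z t, - d < z < h ->
    is_derive (fun s => fx x y z s) t (ftx x y z t);
  reg_yt : forall x y z t, - d < z < h ->
    is_derive (fun s => fy x y z s) t (fty x y z t);
  reg_zt : forall x y z t, - d < z < h ->
    is_derive (fun s => fz x y z s) t (ftz x y z t)
}.

Ltac continuity_2d :=
  repeat first
    [ assumption
    | apply continuity_2d_pt_plus | apply continuity_2d_pt_mult
    | apply continuity_2d_pt_opp
    | apply continuity_2d_pt_id1 | apply continuity_2d_pt_id2
    | apply continuity_2d_pt_const
    | match goal with
      | C : slab_continuous ?d ?h ?G |-
          continuity_2d_pt (fun a b => ?G (@?X a b) (@?Y a b) (@?Z a b) (@?T a b))
            _ _ => apply (slab_continuous_comp d h G X Y Z T _ _ C)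
      end ].

(** Smoothness supplies the mixed derivatives in both orders, such as [fxt] and [ftx], as separate
    continuous functions; Schwarz's theorem in the planes [(x, t)], [(y, t)] and [(z, t)] identifies
    them. *)
Lemma regular_of_C2 (d c h : R) (eta : R -> R) (f : field) :
  (forall s, eta s = h) -> Ck_up_to_boundary 2 d c eta f ->
  exists fx fy fz ft ftx fty ftz, regular d h f fx fy fz ft ftx fty ftz.
Proof.
intros Heta [Cf (fx & fy & fz & ft & Df & Hx & Hy & Hz & Ht)].
destruct Hx as [Cx (fxx & fxy & fxz & fxt & Dx & _ & _ & _ & Cxt & _)].
destruct Hy as [Cy (fyx & fyy & fyz & fyt & Dy & _ & _ & _ & Cyt & _)].
destruct Hz as [Cz (fzx & fzy & fzz & fzt & Dz & _ & _ & _ & Czt & _)].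
destruct Ht as [_ (ftx & fty & ftz & ftt & Dt & [Ctx _] & [Cty _] & [Ctz _] & _)].
(* Below a flat surface the interior is [- d < z < h] for all [x] and [t], so slices in [x], [y] and
   [t] never leave it. *)
unfold fluid_interior in *;
assert (Hin : forall x z t, - d < z < h -> - d < z < eta (x - c * t))
  by (intros; rewrite Heta; assumption).
pose proof (fun x y z t H => Df x y z t (Hin x z t H)) as Df'.
pose proof (fun x y z t H => Dx x y z t (Hin x z t H)) as Dx'.
pose proof (fun x y z t H => Dy x y z t (Hin x z t H)) as Dy'.
pose proof (fun x y z t H => Dz x y z t (Hin x z t H)) as Dz'.
pose proof (fun x y z t H => Dt x y z t (Hin x z t H)) as Dt'.
clear Df Dx Dy Dz Dt.
apply continuous_on_slab with (h := h) in Cf, Cx, Cy, Cz, Ctx, Cty, Ctz, Cxt, Cyt, Czt;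
  try exact Heta.
assert (Etx : forall x y z t, - d < z < h -> fxt x y z t = ftx x y z t).
{ intros x y z t Hz.
  apply (mixed_partials_eq (fun _ _ => True) (fun x t => f x y z t)
    (fun x t => fx x y z t) (fun x t => ft x y z t)
    (fun x t => fxt x y z t) (fun x t => ftx x y z t) x t).
  - apply locally_2d_forall; auto.
  - intros s r _; apply Df', Hz.
  - intros s r _; apply Df', Hz.
  - intros s r _; apply Dx', Hz.
  - intros s r _; apply Dt', Hz.
  - continuity_2d.
  - continuity_2d. }
assert (Ety : forall x y z t, - d < z < h -> fyt x y z t = fty x y z t).
{ intros x y z t Hz.
  apply (mixed_partials_eq (fun _ _ => True) (fun y t => f x y z t)
    (fun y t => fy x y z t) (fun y t => ft x y z t)
    (fun y t => fyt x y z t) (fun y t => fty x y z t) y t).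
  - apply locally_2d_forall; auto.
  - intros s r _; apply Df', Hz.
  - intros s r _; apply Df', Hz.
  - intros s r _; apply Dy', Hz.
  - intros s r _; apply Dt', Hz.
  - continuity_2d.
  - continuity_2d. }
(* Here [z] itself varies, so the neighbourhood has to stay within the slab. *)
assert (Etz : forall x y z t, - d < z < h -> fzt x y z t = ftz x y z t).
{ intros x y z t Hz.
  apply (mixed_partials_eq (fun z _ => - d < z < h) (fun z t => f x y z t)
    (fun z t => fz x y z t) (fun z t => ft x y z t)
    (fun z t => fzt x y z t) (fun z t => ftz x y z t) z t).
  - apply locally_2d_between_fst, Hz.
  - intros s r Hs; apply Df', Hs.
  - intros s r Hs; apply Df', Hs.
  - intros s r Hs; apply Dz', Hs.
  - intros s r Hs; apply Dt', Hs.
  - continuity_2d.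
  - continuity_2d. }
exists fx, fy, fz, ft, ftx, fty, ftz; constructor; try assumption;
  intros x y z t Hz; try (apply Df'; exact Hz); try (apply Dt'; exact Hz).
- rewrite <- Etx by exact Hz; apply Dx', Hz.
- rewrite <- Ety by exact Hz; apply Dy', Hz.
- rewrite <- Etz by exact Hz; apply Dz', Hz.
Qed.

(** * Bernoulli form and the vorticity equation *)

Lemma is_derive_bernoulli (p u v w k : R -> R) (rho s dp du dv dw dk : R) :
  is_derive p s dp -> is_derive u s du -> is_derive v s dv ->
  is_derive w s dw -> is_derive k s dk ->
  is_derive (fun s => - (p s / rho + (u s ^ 2 + v s ^ 2 + w s ^ 2) / 2 + k s)) s
    (- (dp / rho + (u s * du + v s * dv + w s * dw) + dk)).
Proof.
intros Hp Hu Hv Hw Hk; auto_derive.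
- repeat split; try (eexists; eassumption).
- rewrite (is_derive_unique (fun s : R => p s) _ _ Hp), (is_derive_unique (fun s : R => u s) _ _ Hu),
    (is_derive_unique (fun s : R => v s) _ _ Hv), (is_derive_unique (fun s : R => w s) _ _ Hw),
    (is_derive_unique (fun s : R => k s) _ _ Hk).
  unfold Rdiv; set (r := / rho); field.
Qed.

(** Each component of the Bernoulli gradient is a time derivative plus two velocity components, one
    with a coefficient [k] that may depend on [y]; this rule yields all six mixed partials. *)
Lemma is_derive_combination (q k u v : R -> R) (c s dq dk du dv : R) :
  is_derive q s dq -> is_derive k s dk -> is_derive u s du -> is_derive v s dv ->
  is_derive (fun s => q s + k s * u s + c * v s) s
    (dq + (dk * u s + k s * du) + c * dv).
Proof.
intros Hq Hk Hu Hv; auto_derive.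
- repeat split; eexists; eassumption.
- rewrite (is_derive_unique (fun s : R => q s) _ _ Hq), (is_derive_unique (fun s : R => k s) _ _ Hk),
    (is_derive_unique (fun s : R => u s) _ _ Hu), (is_derive_unique (fun s : R => v s) _ _ Hv); ring.
Qed.

Lemma is_derive_difference_const (F G : R -> R) (t dF dG k : R) :
  (forall s, F s - G s = k) ->
  is_derive F t dF -> is_derive G t dG -> dF = dG.
Proof.
intros Hk HF HG.
apply Rminus_diag_uniq.
assert (H : is_derive (fun _ : R => k) t (dF - dG))
  by exact (is_derive_ext _ _ _ _ Hk (is_derive_minus _ _ _ _ _ HF HG)).
rewrite <- (is_derive_unique _ _ _ H); apply Derive_const.
Qed.

(** The gradient of [N] contains only velocities and their time derivatives, so it can be
    differentiated again although only first derivatives of [P] are given. Equality of the mixed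
    partials is then the curl of the momentum equations; the terms with [k1], [k2], [k3] form a
    gradient and drop out. *)
Lemma absolute_vorticity_eq (d h fh f B rho k1 k2 k3 Y1 Y2 Y3 : R)
    (u ux uy uz ut utx uty utz v vx vy vz vt vtx vty vtz
     w wx wy wz wt wtx wty wtz P Px Py Pz : field) :
  regular d h u ux uy uz ut utx uty utz ->
  regular d h v vx vy vz vt vtx vty vtz ->
  regular d h w wx wy wz wt wtx wty wtz ->
  (forall x y z t, - d < z < h -> is_derive (fun s => P s y z t) x (Px x y z t)) ->
  (forall x y z t, - d < z < h -> is_derive (fun s => P x s z t) y (Py x y z t)) ->
  (forall x y z t, - d < z < h -> is_derive (fun s => P x y s t) z (Pz x y z t)) ->
  (forall x y z t, - d < z < h ->
     ut x y z t + u x y z t * ux x y z t + v x y z t * uy x y z t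
     + w x y z t * uz x y z t + fh * w x y z t - (f + B * y) * v x y z t
     = - (1 / rho) * Px x y z t) ->
  (forall x y z t, - d < z < h ->
     vt x y z t + u x y z t * vx x y z t + v x y z t * vy x y z t
     + w x y z t * vz x y z t + (f + B * y) * u x y z t + k1 * y + k2
     = - (1 / rho) * Py x y z t) ->
  (forall x y z t, - d < z < h ->
     wt x y z t + u x y z t * wx x y z t + v x y z t * wy x y z t
     + w x y z t * wz x y z t - fh * u x y z t + k3
     = - (1 / rho) * Pz x y z t) ->
  (forall x y z t, - d < z < h -> ux x y z t + vy x y z t + wz x y z t = 0) ->
  (forall x y z t, - d < z < h -> wy x y z t - vz x y z t = Y1) ->
  (forall x y z t, - d < z < h -> uz x y z t - wx x y z t = Y2) ->
  (forall x y z t, - d < z < h -> vx x y z t - uy x y z t = Y3) ->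
  forall x y z t, - d < z < h ->
    Y1 * ux x y z t + (Y2 + fh) * uy x y z t
      + (Y3 + f + B * y) * uz x y z t = 0 /\
    Y1 * vx x y z t + (Y2 + fh) * vy x y z t
      + (Y3 + f + B * y) * vz x y z t = 0 /\
    Y1 * wx x y z t + (Y2 + fh) * wy x y z t
      + (Y3 + f + B * y) * wz x y z t = B * v x y z t.
Proof.
intros Ru Rv Rw DPx DPy DPz Ex Ey Ez Hdiv H1 H2 H3.
(* Minus the Bernoulli function, of gradient [u_t + (a, b, Y) x u]. *)
set (N := fun x y z t => - (P x y z t / rho
  + (u x y z t ^ 2 + v x y z t ^ 2 + w x y z t ^ 2) / 2
  + (k1 * y ^ 2 / 2 + k2 * y + k3 * z))).
set (Nx := fun x y z t =>
  ut x y z t + - (Y3 + f + B * y) * v x y z t + (Y2 + fh) * w x y z t).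
set (Ny := fun x y z t =>
  vt x y z t + (Y3 + f + B * y) * u x y z t + - Y1 * w x y z t).
set (Nz := fun x y z t =>
  wt x y z t + - (Y2 + fh) * u x y z t + Y1 * v x y z t).
(* The momentum equation replaces the pressure derivative; inserting [vx - uy = Y3] and
   [uz - wx = Y2] turns what is left of the advective terms into a cross product. *)
assert (DNx : forall x y z t, - d < z < h -> is_derive (fun s => N s y z t) x (Nx x y z t)).
{ intros x y z t Hz.
  assert (Hk : is_derive (fun _ : R => k1 * y ^ 2 / 2 + k2 * y + k3 * z) x 0)
    by (auto_derive; [exact I | ring]).
  pose proof (is_derive_bernoulli _ _ _ _ _ rho _ _ _ _ _ _
    (DPx x y z t Hz) (reg_x _ _ _ _ _ _ _ _ _ _ Ru x y z t Hz)
    (reg_x _ _ _ _ _ _ _ _ _ _ Rv x y z t Hz)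
    (reg_x _ _ _ _ _ _ _ _ _ _ Rw x y z t Hz) Hk) as HN.
  cbv beta in HN. evar_last; [exact HN |].
  specialize (Ex x y z t Hz); specialize (H2 x y z t Hz); specialize (H3 x y z t Hz).
  unfold Nx.
  replace (Px x y z t / rho) with (- (- (1 / rho) * Px x y z t))
    by (unfold Rdiv; ring).
  rewrite <- Ex, <- H2, <- H3; ring. }
assert (DNy : forall x y z t, - d < z < h -> is_derive (fun s => N x s z t) y (Ny x y z t)).
{ intros x y z t Hz.
  assert (Hk : is_derive (fun s : R => k1 * s ^ 2 / 2 + k2 * s + k3 * z) y (k1 * y + k2))
    by (auto_derive; [exact I | field]).
  pose proof (is_derive_bernoulli _ _ _ _ _ rho _ _ _ _ _ _
    (DPy x y z t Hz) (reg_y _ _ _ _ _ _ _ _ _ _ Ru x y z t Hz)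
    (reg_y _ _ _ _ _ _ _ _ _ _ Rv x y z t Hz)
    (reg_y _ _ _ _ _ _ _ _ _ _ Rw x y z t Hz) Hk) as HN.
  cbv beta in HN. evar_last; [exact HN |].
  specialize (Ey x y z t Hz); specialize (H1 x y z t Hz); specialize (H3 x y z t Hz).
  unfold Ny.
  replace (Py x y z t / rho) with (- (- (1 / rho) * Py x y z t))
    by (unfold Rdiv; ring).
  rewrite <- Ey, <- H1, <- H3; ring. }
assert (DNz : forall x y z t, - d < z < h -> is_derive (fun s => N x y s t) z (Nz x y z t)).
{ intros x y z t Hz.
  assert (Hk : is_derive (fun s : R => k1 * y ^ 2 / 2 + k2 * y + k3 * s) z k3)
    by (auto_derive; [exact I | ring]).
  pose proof (is_derive_bernoulli _ _ _ _ _ rho _ _ _ _ _ _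
    (DPz x y z t Hz) (reg_z _ _ _ _ _ _ _ _ _ _ Ru x y z t Hz)
    (reg_z _ _ _ _ _ _ _ _ _ _ Rv x y z t Hz)
    (reg_z _ _ _ _ _ _ _ _ _ _ Rw x y z t Hz) Hk) as HN.
  cbv beta in HN. evar_last; [exact HN |].
  specialize (Ez x y z t Hz); specialize (H1 x y z t Hz); specialize (H2 x y z t Hz).
  unfold Nz.
  replace (Pz x y z t / rho) with (- (- (1 / rho) * Pz x y z t))
    by (unfold Rdiv; ring).
  rewrite <- Ez, <- H1, <- H2; ring. }
intros x y z t Hz.
(* The vorticity is constant in time, hence [wty = vtz], [utz = wtx] and [vtx = uty]: the time terms
   will cancel in the curl. *)
pose proof (is_derive_difference_const (fun s => wy x y z s) (fun s => vz x y z s)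
  t _ _ Y1 (fun s => H1 x y z s Hz) (reg_yt _ _ _ _ _ _ _ _ _ _ Rw x y z t Hz)
  (reg_zt _ _ _ _ _ _ _ _ _ _ Rv x y z t Hz)) as T1.
pose proof (is_derive_difference_const (fun s => uz x y z s) (fun s => wx x y z s)
  t _ _ Y2 (fun s => H2 x y z s Hz) (reg_zt _ _ _ _ _ _ _ _ _ _ Ru x y z t Hz)
  (reg_xt _ _ _ _ _ _ _ _ _ _ Rw x y z t Hz)) as T2.
pose proof (is_derive_difference_const (fun s => vx x y z s) (fun s => uy x y z s)
  t _ _ Y3 (fun s => H3 x y z s Hz) (reg_xt _ _ _ _ _ _ _ _ _ _ Rv x y z t Hz)
  (reg_yt _ _ _ _ _ _ _ _ _ _ Ru x y z t Hz)) as T3.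
specialize (Hdiv x y z t Hz).
destruct Ru as [Cu Cux Cuy Cuz Cutx Cuty Cutz Dux Duy Duz _ Dutx Duty Dutz _ _ _].
destruct Rv as [Cv Cvx Cvy Cvz Cvtx Cvty Cvtz Dvx Dvy Dvz _ Dvtx Dvty Dvtz _ _ _].
destruct Rw as [Cw Cwx Cwy Cwz Cwtx Cwty Cwtz Dwx Dwy Dwz _ Dwtx Dwty Dwtz _ _ _].
assert (Dcst : forall k s : R, is_derive (fun _ : R => k) s 0)
  by (intros; apply (is_derive_const (V := R_NormedModule))).
assert (DY : forall s, is_derive (fun s => Y3 + f + B * s) s B)
  by (intros s; auto_derive; [exact I | ring]).
assert (DmY : forall s, is_derive (fun s => - (Y3 + f + B * s)) s (- B))
  by (intros s; auto_derive; [exact I | ring]).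
(* The exchanges in [(y, z)], [(x, z)] and [(x, y)] lead, with incompressibility, to the equations
   for [u], [v] and [w] respectively. *)
assert (Hyz := mixed_partials_eq (fun _ z => - d < z < h) (fun y z => N x y z t)
  (fun y z => Ny x y z t) (fun y z => Nz x y z t) _ _ y z
  (locally_2d_between_snd _ _ _ _ Hz)
  (fun y z H => DNy x y z t H) (fun y z H => DNz x y z t H)
  (fun y z H => is_derive_combination _ _ _ _ _ _ _ _ _ _
     (Dvtz x y z t H) (Dcst _ z) (Duz x y z t H) (Dwz x y z t H))
  (fun y z H => is_derive_combination _ _ _ _ _ _ _ _ _ _
     (Dwty x y z t H) (Dcst _ y) (Duy x y z t H) (Dvy x y z t H))).
assert (Hxz := mixed_partials_eq (fun _ z => - d < z < h) (fun x z => N x y z t)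
  (fun x z => Nx x y z t) (fun x z => Nz x y z t) _ _ x z
  (locally_2d_between_snd _ _ _ _ Hz)
  (fun x z H => DNx x y z t H) (fun x z H => DNz x y z t H)
  (fun x z H => is_derive_combination _ _ _ _ _ _ _ _ _ _
     (Dutz x y z t H) (Dcst _ z) (Dvz x y z t H) (Dwz x y z t H))
  (fun x z H => is_derive_combination _ _ _ _ _ _ _ _ _ _
     (Dwtx x y z t H) (Dcst _ x) (Dux x y z t H) (Dvx x y z t H))).
(* Only this exchange differentiates the coefficient [Y3 + f + B y] in [y]; that is the source of
   [B v]. *)
assert (Hxy := mixed_partials_eq (fun _ _ => - d < z < h) (fun x y => N x y z t)
  (fun x y => Nx x y z t) (fun x y => Ny x y z t) _ _ x y
  (locally_2d_forall _ _ _ (fun _ _ => Hz))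
  (fun x y H => DNx x y z t H) (fun x y H => DNy x y z t H)
  (fun x y H => is_derive_combination _ _ _ _ _ _ _ _ _ _
     (Duty x y z t H) (DmY y) (Dvy x y z t H) (Dwy x y z t H))
  (fun x y H => is_derive_combination _ _ _ _ _ _ _ _ _ _
     (Dvtx x y z t H) (Dcst _ x) (Dux x y z t H) (Dwx x y z t H))).
cbv beta in Hyz, Hxz, Hxy.
specialize (Hyz ltac:(continuity_2d) ltac:(continuity_2d)).
specialize (Hxz ltac:(continuity_2d) ltac:(continuity_2d)).
specialize (Hxy ltac:(continuity_2d) ltac:(continuity_2d)).
rewrite T1 in Hyz; rewrite T2 in Hxz; rewrite T3 in Hxy.
repeat split.
- replace (ux x y z t) with (- vy x y z t - wz x y z t) by lra; lra.
- replace (vy x y z t) with (- ux x y z t - wz x y z t) by lra; lra.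
- replace (wz x y z t) with (- ux x y z t - vy x y z t) by lra; lra.
Qed.

(** * Restriction to the bed and conclusion *)

Lemma bed_extension (d h c : R) (E : R -> R) :
  - d < h -> is_lim_seq (fun n => E (above_bed d h n)) (E (- d)) ->
  (forall z, - d < z < h -> E z = c) -> E (- d) = c.
Proof.
intros Hh HE Hc.
assert (Heq : Finite (E (- d)) = Finite c); [| congruence].
rewrite <- (is_lim_seq_unique _ _ HE).
rewrite (Lim_seq_ext _ (fun _ => c)); [apply Lim_seq_const |].
intros n; apply Hc, above_bed_interior, Hh.
Qed.

Ltac bed_limit :=
  cbv beta;
  repeat lazymatch goal with
    | |- is_lim_seq (fun n => _ + _) _ => apply is_lim_seq_plus'
    | |- is_lim_seq (fun n => _ - _) _ => apply is_lim_seq_minus'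
    | |- is_lim_seq (fun n => _ * _) _ => apply is_lim_seq_mult'
    | |- is_lim_seq (fun n => _ (above_bed _ _ n) _) _ => apply slab_bed_lim
    | |- is_lim_seq _ _ => apply is_lim_seq_const
    | |- _ => assumption
    end.

(** The vorticity equations extend to the bed by continuity and meet the hypotheses of
    [bed_vorticity_zero]. They contain no time derivative, so the instant [t = 0] suffices. *)
Lemma flat_constant_vorticity_zero
    (Omega Rad g rho Patm d c L phi : R) (u v w P : field) (eta : R -> R)
    (Y1 Y2 Y3 : R) :
  0 < coriolis_beta Omega Rad phi ->
  water_flow Omega Rad g rho Patm d c L phi u v w P eta ->
  constant_vorticity d c eta u v w Y1 Y2 Y3 ->
  Y2 + coriolis_fhat Omega phi <> 0 ->
  flat_surface eta ->
  Y1 = 0 /\ Y2 = 0 /\ Y3 = 0.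
Proof.
intros HB [Hsurf Su Sv Sw [_ (Px & Py & Pz & Pt & DP & _)]
  Ex Ey Ez Hinc _ _ Hbed] Hvort Hb [h Heta].
assert (Hh : - d < h)
  by (rewrite <- (Heta 0); apply (surface_above_bed _ _ _ Hsurf)).
assert (Hin : forall x y z t, - d < z < h -> fluid_interior d c eta x y z t)
  by (intros; unfold fluid_interior; rewrite Heta; assumption).
destruct (regular_of_C2 d c h eta u Heta Su)
  as (ux & uy & uz & ut & utx & uty & utz & Ru).
destruct (regular_of_C2 d c h eta v Heta Sv)
  as (vx & vy & vz & vt & vtx & vty & vtz & Rv).
destruct (regular_of_C2 d c h eta w Heta Sw)
  as (wx & wy & wz & wt & wtx & wty & wtz & Rw).
assert (DP' := fun x y z t H => DP x y z t (Hin x y z t H)).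
assert (Hpartials : forall q qx qy qz qt qtx qty qtz,
  regular d h q qx qy qz qt qtx qty qtz -> forall x y z t, - d < z < h ->
  Defs.Dx q x y z t = qx x y z t /\ Dy q x y z t = qy x y z t /\
  Dz q x y z t = qz x y z t /\ Dt q x y z t = qt x y z t).
{ intros q qx qy qz qt qtx qty qtz Rq x y z t Hz; repeat split;
    apply is_derive_unique;
    [ apply (reg_x _ _ _ _ _ _ _ _ _ _ Rq) | apply (reg_y _ _ _ _ _ _ _ _ _ _ Rq)
    | apply (reg_z _ _ _ _ _ _ _ _ _ _ Rq) | apply (reg_t _ _ _ _ _ _ _ _ _ _ Rq)];
    exact Hz. }
assert (Hvort' : forall x y z t, - d < z < h ->
  wy x y z t - vz x y z t = Y1 /\ uz x y z t - wx x y z t = Y2 /\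
  vx x y z t - uy x y z t = Y3).
{ intros x y z t Hz; specialize (Hvort x y z t (Hin x y z t Hz)).
  unfold vorticity in Hvort.
  destruct (Hpartials _ _ _ _ _ _ _ _ Ru x y z t Hz) as (_ & <- & <- & _).
  destruct (Hpartials _ _ _ _ _ _ _ _ Rv x y z t Hz) as (<- & _ & <- & _).
  destruct (Hpartials _ _ _ _ _ _ _ _ Rw x y z t Hz) as (<- & <- & _ & _).
  injection Hvort; auto. }
assert (Hdiv : forall x y z t, - d < z < h ->
  ux x y z t + vy x y z t + wz x y z t = 0).
{ intros x y z t Hz.
  destruct (Hpartials _ _ _ _ _ _ _ _ Ru x y z t Hz) as (<- & _ & _ & _).
  destruct (Hpartials _ _ _ _ _ _ _ _ Rv x y z t Hz) as (_ & <- & _ & _).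
  destruct (Hpartials _ _ _ _ _ _ _ _ Rw x y z t Hz) as (_ & _ & <- & _).
  apply Hinc, Hin, Hz. }
set (fh := coriolis_fhat Omega phi) in *.
set (f := coriolis_f Omega phi).
set (B := coriolis_beta Omega Rad phi) in *.
(* The constants [k1] and [k2] are the centripetal terms of the [y]-equation; [k3] joins gravity to
   that of the [z]-equation. *)
assert (Hvt := absolute_vorticity_eq d h fh f B rho (fh ^ 2 / 4) (fh * f / 4 * Rad)
  (g - fh ^ 2 / 4 * Rad) Y1 Y2 Y3
  _ _ _ _ _ _ _ _ _ _ _ _ _ _ _ _ _ _ _ _ _ _ _ _ P Px Py Pz Ru Rv Rw
  (fun x y z t H => proj1 (DP' x y z t H))
  (fun x y z t H => proj1 (proj2 (DP' x y z t H)))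
  (fun x y z t H => proj1 (proj2 (proj2 (DP' x y z t H))))).
lapply Hvt; clear Hvt; [intros Hvt |].
2:{ intros x y z t Hz; specialize (Ex x y z t (Hin x y z t Hz)).
  unfold euler_x, material in Ex.
  destruct (Hpartials _ _ _ _ _ _ _ _ Ru x y z t Hz) as (<- & <- & <- & <-).
  assert (HP : Defs.Dx P x y z t = Px x y z t)
    by (apply is_derive_unique, DP', Hz).
  rewrite HP in Ex.
  fold fh f B in Ex; lra. }
lapply Hvt; clear Hvt; [intros Hvt |].
2:{ intros x y z t Hz; specialize (Ey x y z t (Hin x y z t Hz)).
  unfold euler_y, material in Ey.
  destruct (Hpartials _ _ _ _ _ _ _ _ Rv x y z t Hz) as (<- & <- & <- & <-).
  assert (HP : Dy P x y z t = Py x y z t)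
    by (apply is_derive_unique, DP', Hz).
  rewrite HP in Ey.
  fold fh f B in Ey; lra. }
lapply Hvt; clear Hvt; [intros Hvt |].
2:{ intros x y z t Hz; specialize (Ez x y z t (Hin x y z t Hz)).
  unfold euler_z, material in Ez.
  destruct (Hpartials _ _ _ _ _ _ _ _ Rw x y z t Hz) as (<- & <- & <- & <-).
  assert (HP : Dz P x y z t = Pz x y z t)
    by (apply is_derive_unique, DP', Hz).
  rewrite HP in Ez.
  fold fh f B in Ez; lra. }
specialize (Hvt Hdiv (fun x y z t H => proj1 (Hvort' x y z t H))
  (fun x y z t H => proj1 (proj2 (Hvort' x y z t H)))
  (fun x y z t H => proj2 (proj2 (Hvort' x y z t H)))).
destruct Ru as [Cu Cux Cuy Cuz _ _ _ Dux Duy _ _ _ _ _ _ _ _].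
destruct Rv as [Cv Cvx Cvy Cvz _ _ _ Dvx Dvy _ _ _ _ _ _ _ _].
destruct Rw as [Cw Cwx Cwy Cwz _ _ _ Dwx Dwy _ _ _ _ _ _ _ _].
(* [w] is identically zero on the bed, hence so are its tangential derivatives. *)
assert (Bwx : forall x y, wx x y (- d) 0 = 0).
{ intros x y.
  rewrite <- (is_derive_unique _ _ _ (bed_trace_is_derive_x d h w wx x y 0 Hh Cw Cwx Dwx)).
  rewrite (Derive_ext _ (fun _ => 0)); [apply Derive_const | auto]. }
assert (Bwy : forall x y, wy x y (- d) 0 = 0).
{ intros x y.
  rewrite <- (is_derive_unique _ _ _ (bed_trace_is_derive_y d h w wy x y 0 Hh Cw Cwy Dwy)).
  rewrite (Derive_ext _ (fun _ => 0)); [apply Derive_const | auto]. }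
assert (Bvz : forall x y, vz x y (- d) 0 = - Y1).
{ intros x y.
  assert (E := bed_extension d h Y1 (fun z => wy x y z 0 - vz x y z 0) Hh
    ltac:(bed_limit) (fun z Hz => proj1 (Hvort' x y z 0 Hz))).
  cbv beta in E; rewrite Bwy in E; lra. }
assert (Buz : forall x y, uz x y (- d) 0 = Y2).
{ intros x y.
  assert (E := bed_extension d h Y2 (fun z => uz x y z 0 - wx x y z 0) Hh
    ltac:(bed_limit) (fun z Hz => proj1 (proj2 (Hvort' x y z 0 Hz)))).
  cbv beta in E; rewrite Bwx in E; lra. }
(* [m = Y2] is the bed value of [uz], and the factor [- a] of [e + B y] in the equation for [v] is
   the bed value [- Y1] of [vz]. *)
destruct (bed_vorticity_zero Y1 (Y2 + fh) (Y3 + f) B Y2 Y3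
  (fun x y => u x y (- d) 0) (fun x y => v x y (- d) 0)
  (fun x y => ux x y (- d) 0) (fun x y => uy x y (- d) 0)
  (fun x y => vx x y (- d) 0) (fun x y => vy x y (- d) 0)
  (fun x y => wz x y (- d) 0)) as (? & ? & ?); auto; try (intros x y).
- apply (bed_trace_is_derive_x d h); assumption.
- apply (bed_trace_is_derive_y d h); assumption.
- apply (bed_trace_is_derive_x d h); assumption.
- apply (bed_trace_is_derive_y d h); assumption.
- apply (bed_extension d h Y3 (fun z => vx x y z 0 - uy x y z 0) Hh);
    [bed_limit | intros z Hz; apply Hvort', Hz].
- apply (bed_extension d h 0 (fun z => ux x y z 0 + vy x y z 0 + wz x y z 0) Hh);
    [bed_limit | intros z Hz; apply Hdiv, Hz].
- assert (E := bed_extension d h 0 (fun z => Y1 * ux x y z 0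
    + (Y2 + fh) * uy x y z 0 + (Y3 + f + B * y) * uz x y z 0) Hh
    ltac:(bed_limit) (fun z Hz => proj1 (Hvt x y z 0 Hz))).
  cbv beta in E; rewrite Buz in E; lra.
- assert (E := bed_extension d h 0 (fun z => Y1 * vx x y z 0
    + (Y2 + fh) * vy x y z 0 + (Y3 + f + B * y) * vz x y z 0) Hh
    ltac:(bed_limit) (fun z Hz => proj1 (proj2 (Hvt x y z 0 Hz)))).
  cbv beta in E; rewrite Bvz in E; lra.
- assert (E := bed_extension d h 0 (fun z => Y1 * wx x y z 0
    + (Y2 + fh) * wy x y z 0 + (Y3 + f + B * y) * wz x y z 0 - B * v x y z 0) Hh
    ltac:(bed_limit)
    (fun z Hz => Rminus_diag_eq _ _ (proj2 (proj2 (Hvt x y z 0 Hz))))).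
  cbv beta in E; rewrite Bwx, Bwy in E; lra.
Qed.

Theorem theorem4p1
  (Omega Rad g rho Patm d c L phi : R)
  (hOmega : 0 < Omega) (hRad : 0 < Rad) (hg : 0 < g) (hrho : 0 < rho)
  (hd : 0 < d) (hc : 0 < c) (hL : 0 < L)
  (hphi : - (PI / 2) < phi < PI / 2) :
  (~ exists (u v w P : field) (eta : R -> R) (Y1 Y2 Y3 : R),
       water_flow Omega Rad g rho Patm d c L phi u v w P eta /\
       constant_vorticity d c eta u v w Y1 Y2 Y3 /\
       Y2 + coriolis_fhat Omega phi <> 0 /\
       Y3 + coriolis_f Omega phi <> 0 /\
       flat_surface eta /\
       (Y1, Y2, Y3) <> (0, 0, 0))
  /\
  (forall (u v w P : field) (eta : R -> R) (Y1 Y2 Y3 : R),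
       water_flow Omega Rad g rho Patm d c L phi u v w P eta ->
       constant_vorticity d c eta u v w Y1 Y2 Y3 ->
       Y2 + coriolis_fhat Omega phi <> 0 ->
       Y3 + coriolis_f Omega phi <> 0 ->
       flat_surface eta ->
       (Y1, Y2, Y3) = (0, 0, 0)).
Proof.
(* The latitude lies strictly between the poles, so [cos phi > 0]. *)
assert (HB : 0 < coriolis_beta Omega Rad phi).
{ unfold coriolis_beta, coriolis_fhat.
  apply Rdiv_lt_0_compat; [| exact hRad].
  apply Rmult_lt_0_compat; [lra | apply cos_gt_0; lra]. }
assert (Hzero : forall (u v w P : field) (eta : R -> R) (Y1 Y2 Y3 : R),
       water_flow Omega Rad g rho Patm d c L phi u v w P eta ->
       constant_vorticity d c eta u v w Y1 Y2 Y3 ->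
       Y2 + coriolis_fhat Omega phi <> 0 ->
       Y3 + coriolis_f Omega phi <> 0 ->
       flat_surface eta ->
       (Y1, Y2, Y3) = (0, 0, 0)).
{ intros u v w P eta Y1 Y2 Y3 Hflow Hvort H2 _ Hflat.
  destruct (flat_constant_vorticity_zero _ _ _ _ _ _ _ _ _ _ _ _ _ _ _ _ _
    HB Hflow Hvort H2 Hflat) as (-> & -> & ->); reflexivity. }
split; [| exact Hzero].
intros (u & v & w & P & eta & Y1 & Y2 & Y3 & Hflow & Hvort & H2 & H3 & Hflat & Hne).
exact (Hne (Hzero u v w P eta Y1 Y2 Y3 Hflow Hvort H2 H3 Hflat)).
Qed.
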